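(* For every integer $r\ge3$, there exist infinitely many natural numbers $n$ for which there exist a $k$ with $k>\sum_{i=0}^{r}\binom{n-1}{i}$ and a surjective $k$-colouring $\Delta:\mathbb{N}^{(r)}\to[k]$ such that \[\mathcal{F}_\Delta\cap J_{r,n}=\emptyset,\qquad\text{where } J_{r,n}=\left(\sum_{i=0}^{r}\binom{n-1}{i},\ \sum_{i=0}^{r}\binom{n}{i}\right].\]
   Context: Natural numbers are positive integers, $\mathbb{N}=\{1,2,\dots\}$, and $[k]=\{1,\dots,k\}$. For a set $X$, $X^{(r)}$ denotes the family of all subsets of $X$ of cardinality $r$ (the edges of the complete $r$-uniform hypergraph on $X$). For $X\subset\mathbb{N}$, let $\gamma_\Delta(X)=|\Delta(X^{(r)})|$ be the number of colours appearing on $r$-subsets of $X$. Define $\mathcal{F}_\Delta=\{\gamma_\Delta(X): X\subset\mathbb{N},\ X \text{ infinite}\}$. *)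

(* Defs.v *)
From HB Require Import structures.
From mathcomp Require Import all_boot finmap.
From mathcomp Require Import boolp classical_sets functions cardinality.

Set Implicit Arguments.
Unset Strict Implicit.
Unset Printing Implicit Defensive.

Local Open Scope nat_scope.
Local Open Scope fset_scope.
Local Open Scope classical_set_scope.

(* The natural numbers of the source are the positive integers, so the ground
   set is a proper subset of [nat]. *)
Definition posnat : set nat := [set m : nat | 0 < m].

(* [k] = {1, ..., k} *)
Definition palette (k : nat) : set nat := [set c : nat | 0 < c <= k].

(* X^(r) *)
Definition rsubsets (r : nat) (X : set nat) : set {fset nat} :=
  [set A : {fset nat} | [set` A] `<=` X /\ #|` A| = r].

(* A colouring is carried by a total function on finite sets; only its values
   on [rsubsets r posnat] are constrained or used. *)
Definition surjective_colouring (r k : nat) (Delta : {fset nat} -> nat) : Prop :=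
  set_fun (rsubsets r posnat) (palette k) Delta /\
  set_surj (rsubsets r posnat) (palette k) Delta.

(* [fset_set] is a junk value on infinite sets; for X a set of positive
   integers and a colouring as above, the image is included in [palette k],
   hence finite. *)
Definition gamma (r : nat) (Delta : {fset nat} -> nat) (X : set nat) : nat :=
  #|` fset_set (Delta @` rsubsets r X)|.

Definition calF (r : nat) (Delta : {fset nat} -> nat) : set nat :=
  gamma r Delta @` [set X : set nat | X `<=` posnat /\ infinite_set X].

Definition binsum (r m : nat) : nat := \sum_(0 <= i < r.+1) 'C(m, i).

(* The subtraction in [n.-1] is truncated, hence the intended use is 0 < n. *)
Definition J (r n : nat) : set nat :=
  [set m : nat | binsum r n.-1 < m <= binsum r n].

(* Main.v *)
Require Import Defs.
From HB Require Import structures.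
From mathcomp Require Import all_boot all_algebra finmap zify.

Local Open Scope nat_scope.

(** Write S(m) for [binsum r m].  Let N = n + 1 with n >= r, and let a finite
    family H of subsets of {1, ..., N} of size at most r, not containing all of
    them, be given.  Colour an r-set e by its trace on {1, ..., N} if that trace
    belongs to H, and by one extra colour otherwise.  An infinite X containing
    {1, ..., N} realises every subset of {1, ..., N} of size at most r as a
    trace, so it sees all |H| + 1 colours.  An X that misses x sees at most
    one colour more than there are members of H avoiding x.  The interval (S(n-1), S(n)] is therefore skipped
    as soon as |H| = S(n) and every x is avoided by fewer than S(n-1) members
    of H.

    Start from the family P of the subsets of size at most r and of the same
    parity as r.  Forgetting whether a fixed point is present is a bijection
    from P to the subsets of size at most r of the other n points, so
    |P| = S(n), and likewise exactly S(n-1) members of P avoid a given x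
    ([card_parity_sets]).  This falls short by one for every x.  To gain it,
    place the N points on a circle and replace, for each x, the arc of the r - 2
    points just before x (a member of P) by the arc of r - 1 points that ends in
    x.  The new arcs have the wrong parity to collide with P, so the size of the
    family does not change; no set loses a point, so no x is avoided more often
    than before; and x has entered one set that avoided it
    ([deletion_sensitive_family]).  Distinct points give distinct arcs because
    arcs are short compared with the circle ([arc_inj], [arcU_inj]). *)

(** * Sets of prescribed parity *)

Definition parity_sets {T : finType} (r : nat) (D : {set T}) : {set {set T}} :=
  [set A : {set T} | [&& A \subset D, #|A| <= r & odd #|A| == odd r]].

Lemma binsumS r m : binsum r.+1 m = binsum r m + 'C(m, r.+1).
Proof. by rewrite /binsum big_nat_recr. Qed.

(** The two families with bounds r and r + 2 differ exactly in the sets of size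
    r + 2, and Pascal's rule splits their number 'C(d, r + 2) into the two terms
    by which the binomial sums for d - 1 differ. *)
Lemma card_parity_sets {T : finType} (r : nat) (D : {set T}) :
  0 < #|D| -> #|parity_sets r D| = binsum r #|D|.-1.
Proof.
move=> D0.
suff [] : #|parity_sets r D| = binsum r #|D|.-1 /\
          #|parity_sets r.+1 D| = binsum r.+1 #|D|.-1 by [].
elim: r => [|r [IH0 IH1]].
  rewrite {2}/binsum big_nat_recr//= /binsum !big_nat1 bin0 bin1; split.
    rewrite -(cards1 (set0 : {set T})); apply: eq_card => A; rewrite !inE.
    rewrite leqn0 cards_eq0; case: eqP => [->|_]; last by rewrite andbF.
    by rewrite sub0set cards0.
  rewrite add1n prednK// -[RHS]bin1 -cards_draws; apply: eq_card => A.
  by rewrite !inE; case: #|A| => [|[|]].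
split=> //; rewrite !binsumS -addnA -IH0.
have -> : 'C(#|D|.-1, r.+1) + 'C(#|D|.-1, r.+2) = 'C(#|D|, r.+2).
  by rewrite -[in RHS](prednK D0) binS addnC.
rewrite -cards_draws -cardsUI [X in _ = _ + X](_ : _ = 0) ?addn0; last first.
  by apply/eqP; rewrite cards_eq0; apply/eqP/setP => A; rewrite !inE; lia.
apply: eq_card => A; rewrite !inE; case: (A \subset D) => //=.
by lia.
Qed.

(** * Enlarging some members of the parity family *)

(** Adds to A every x with f x = A: when f is injective this is at most one
    point, and the sets that are not values of f stay as they are. *)
Definition extend {T : finType} (f : T -> {set T}) (A : {set T}) : {set T} :=
  A :|: [set x | f x == A].

Lemma extend_outside {T : finType} (f : T -> {set T}) (A : {set T}) :
  (forall x, f x != A) -> extend f A = A.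
Proof.
move=> fA; apply/setP => x; rewrite !inE orbC.
by rewrite (negbTE (fA x)).
Qed.

Lemma extend_image {T : finType} (f : T -> {set T}) (x : T) :
  injective f -> extend f (f x) = x |: f x.
Proof.
by move=> finj; apply/setP => y; rewrite !inE orbC (inj_eq finj).
Qed.

(** The family is the image of the parity family under [extend f], which is
    injective since enlarged sets have changed parity.  As [extend f] only
    enlarges, the members avoiding x come from parity sets avoiding x; one of
    the latter, the set f x, is lost because it receives x.  The sets f x
    themselves have been displaced, which provides a set outside the family. *)
Lemma deletion_sensitive_family {T : finType} {n r : nat} {f : T -> {set T}} :
    #|T| = n.+1 -> 0 < n -> 1 < r -> injective f ->
    (forall x, #|f x| = r.-2) -> (forall x, x \notin f x) ->
    injective (fun x => x |: f x) ->
  exists H : {set {set T}},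
    [/\ #|H| = binsum r n, forall B, B \in H -> #|B| <= r,
        exists2 B : {set T}, B \notin H & #|B| <= r &
        forall x, #|[set B in H | x \notin B]| < binsum r n.-1].
Proof.
move=> cT n0 r1 finj cf xf finj'.
pose P := parity_sets r [set: T].
have extendP A : A \in P ->
    extend f A = A \/ exists2 x, A = f x & extend f A = x |: f x.
  have [/existsP[x /eqP <-] _|/existsPn fA _] := boolP [exists x, f x == A].
    by right; exists x; rewrite ?extend_image.
  by left; apply: extend_outside.
have card_new x : #|x |: f x| = r.-1 by rewrite cardsU1 xf cf; lia.
have extend_injP : {in P &, injective (extend f)}.
  move=> A B AP BP; move: (AP) (BP); rewrite !inE.
  case: (extendP A AP) (extendP B BP) => [->|[x -> ->]] [->|[y -> ->]] //.
  - by move=> + _ AE; rewrite AE card_new; lia.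
  - by move=> _ + BE; rewrite -BE card_new; lia.
  - by move=> _ _ /finj' ->.
exists (extend f @: P); split.
- by rewrite card_in_imset// card_parity_sets cardsT cT.
- move=> _ /imsetP[A AP ->]; case: (extendP A AP) => [->|[x _ ->]].
    by move: AP; rewrite !inE => /and3P[].
  by rewrite card_new; lia.
- have /card_gt0P[x _] : 0 < #|T| by rewrite cT.
  exists (f x); last by rewrite cf; lia.
  apply/imsetP => -[A AP fxA]; move: (fxA).
  case: (extendP A AP) => [->|[y _ ->]].
    move=> fA; move: fxA; rewrite -fA extend_image// => /setP/(_ x).
    by rewrite !inE eqxx (negbTE (xf x)).
  by move=> fA; have := card_new y; rewrite -fA cf; lia.
- move=> x; have -> : binsum r n.-1 = #|parity_sets r [set~ x]|.
    have cx : #|[set~ x]| = n by rewrite cardsC1 cT.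
    by rewrite card_parity_sets cx.
  rewrite [X in _ < X](cardsD1 (f x)) !inE.
  have -> : f x \subset [set~ x] by rewrite subsetC sub1set inE xf.
  rewrite cf (_ : _ && _) ?add1n; last by lia.
  rewrite ltnS (leq_trans _ (leq_imset_card (extend f) _))//.
  apply/subset_leq_card/subsetP => _ /setIdP[/imsetP[A AP ->] xA].
  apply: imset_f; move: AP xA; rewrite !inE => /and3P[_ -> ->].
  rewrite negb_or andbT subsetC sub1set inE => /andP[-> fx].
  by rewrite eq_sym fx.
Qed.

(** * Arcs of a cycle *)

Import GRing.Theory.

(** The m points preceding x on the cycle 'I_n.+1: subtraction is modulo n + 1,
    and its result is then compared as a natural number. *)
Definition arc {n : nat} (m : nat) (x : 'I_n.+1) : {set 'I_n.+1} :=
  [set y : 'I_n.+1 | 0 < (x - y)%R <= m].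

(** The unit step is [inord 1] and not the ring unit, as 'I_n.+1 is a ring only
    for positive n. *)
Lemma val_ord_succ {n : nat} (d : 'I_n.+1) :
  (d + inord 1)%R = (if d < n then d.+1 else 0) :> nat.
Proof.
case: n d => [|n] d; first by rewrite [(_ + _)%R]ord1; case: d => [[]].
rewrite /= inordK//; case: ltnP => dn; first by rewrite modn_small; lia.
by rewrite (_ : d + 1 = n.+2) ?modnn//; have := ltn_ord d; lia.
Qed.

Lemma val_ord_one {n : nat} : 0 < n -> (inord 1 : 'I_n.+1) = 1 :> nat.
Proof. by move=> n0; rewrite inordK. Qed.

Lemma eq_ord_sub {n : nat} (x y : 'I_n.+1) :
  (x == y) = ((x - y)%R == 0 :> nat).
Proof. by rewrite -subr_eq0. Qed.

Lemma in_arcU {n : nat} (m : nat) (x y : 'I_n.+1) :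
  (y \in x |: arc m x) = ((x - y)%R <= m).
Proof.
rewrite !inE eq_sym eq_ord_sub.
by case: (nat_of_ord (x - y)%R).
Qed.

(** The arc before x is nonempty, and x is determined by it: it is the unique
    point outside the arc whose predecessor is inside. *)
Lemma arc_inj {n m : nat} : 0 < m < n -> injective (@arc n m).
Proof.
move=> /andP[m0 mn] x x' E.
have /setP/(_ x') := E; have /setP/(_ (x' - inord 1)%R) := E.
rewrite !inE (subrr x') ltnn subKr val_ord_one; last by lia.
rewrite opprB addrA addrAC val_ord_succ => d1 d0.
apply/eqP; rewrite eq_ord_sub.
move: d0 d1; set d := (x - x')%R; have := ltn_ord d.
by rewrite andFb; case: (ltnP d n); lia.
Qed.

(** Here x is the unique point inside whose successor is outside. *)
Lemma arcU_inj {n m : nat} : m < n -> injective (fun x => x |: @arc n m x).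
Proof.
move=> mn x x' E.
have /setP/(_ x') := E; have /setP/(_ (x' + inord 1)%R) := E.
rewrite !in_arcU subrr leq0n.
have := val_ord_succ (x - (x' + inord 1))%R.
have := val_ord_succ (x' - (x' + inord 1))%R.
rewrite !opprD !addrA !addrNK subrr add0r.
set d := (x - x' - inord 1)%R; have := ltn_ord d.
set e := (- inord 1)%R; have := ltn_ord e.
move=> en dn; rewrite [nat_of_ord 0%R]/= => e0 dE d1 d2.
apply/eqP; rewrite eq_ord_sub dE; apply/eqP; move: e0 d1 d2; rewrite dE.
by case: (ltnP e n); case: (ltnP d n); lia.
Qed.

Lemma card_arc {n m : nat} (x : 'I_n.+1) : m < n -> #|arc m x| = m.
Proof.
move=> mn; have f_inj : injective (fun i : 'I_m => x - inord i.+1)%R.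
  move=> i j /addrI/oppr_inj/(congr1 val)/=.
  have im := ltn_ord i; have jm := ltn_ord j.
  by rewrite !inordK; [move=> [/val_inj] | lia | lia].
rewrite -[RHS]card_ord -(card_imset _ f_inj); apply: eq_card => y.
rewrite inE; apply/idP/imsetP => [/andP[d0 dm]|[i _ ->]].
  have dm' : (x - y)%R.-1 < m by lia.
  exists (Ordinal dm') => //.
  by rewrite [nat_of_ord _](_ : _ = (x - y)%R.-1)// prednK// inord_val subKr.
by rewrite subKr inordK; have := ltn_ord i; lia.
Qed.

Lemma notin_arc {n : nat} (m : nat) (x : 'I_n.+1) : x \notin arc m x.
Proof. by rewrite inE subrr. Qed.

Lemma exists_arc_family (n r : nat) : 2 < r <= n ->
  exists H : {set {set 'I_n.+1}},
    [/\ #|H| = binsum r n, forall B, B \in H -> #|B| <= r,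
        exists2 B : {set 'I_n.+1}, B \notin H & #|B| <= r &
        forall x, #|[set B in H | x \notin B]| < binsum r n.-1].
Proof.
move=> rn; apply: (deletion_sensitive_family (f := arc r.-2));
  rewrite ?card_ord//; try lia.
- by apply: arc_inj; lia.
- by move=> x; apply: card_arc; lia.
- exact: notin_arc.
- by apply: arcU_inj; lia.
Qed.

(** * Colouring by traces *)

From mathcomp Require Import boolp classical_sets functions cardinality.

Local Open Scope nat_scope.
Local Open Scope classical_set_scope.

Definition trace (n : nat) (e : {fset nat}) : {set 'I_n.+1} :=
  [set i : 'I_n.+1 | i.+1 \in e]%SET.

(** The members of H get the colours 1, ..., |H|; since [index] returns the size
    of the list on absent elements, all other traces get the colour |H| + 1. *)
Definition trace_colour {n : nat} (H : {set {set 'I_n.+1}}) (e : {fset nat}) :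
  nat := (index (trace n e) (enum H)).+1.

Lemma trace_colour_le {n : nat} (H : {set {set 'I_n.+1}}) (e : {fset nat}) :
  0 < trace_colour H e <= #|H|.+1.
Proof. by rewrite /trace_colour /= ltnS cardE index_size. Qed.

Lemma infinite_fset_card {X : set nat} (m : nat) : infinite_set X ->
  exists2 E : {fset nat}, [set` E] `<=` X & #|` E| = m.
Proof.
move=> /(infinite_set_fset m)[B BX mB]; exists [fset x in take m B]%fset.
  by move=> x /=; rewrite inE => /mem_take/BX.
by rewrite card_fseq undup_id ?take_uniq ?fset_uniq// size_takel.
Qed.

(** A small set of points of the cycle is completed to an r-set with elements of
    X beyond n + 1, which do not affect the trace. *)
Lemma trace_surj {n r : nat} {X : set nat} (B : {set 'I_n.+1}) :
    infinite_set X -> (forall i, i \in B -> X i.+1) -> #|B| <= r ->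
  exists2 e, rsubsets r X e & trace n e = B.
Proof.
move=> Xinf BX cB.
have Yinf : infinite_set (X `\` `I_n.+2).
  by apply: infinite_setD => //; apply: finite_II.
have [E EY cE] := infinite_fset_card (r - #|B|) Yinf.
pose F := [fset (i : 'I_n.+1).+1 | i in B]%fset.
have cF : #|` F| = #|B|.
  rewrite card_imfset/=; last by move=> i j [/val_inj].
  by rewrite cardE; apply: perm_size; apply: uniq_perm; rewrite ?enum_uniq.
have EF : [disjoint E & F]%fset.
  apply/fdisjointP => x /EY[_ /= xn]; apply/imfsetP => -[i /= _ xi].
  by apply: xn; rewrite xi ltnS ltn_ord.
exists (E `|` F)%fset.
  split=> [x /=|].
    by rewrite inE => /orP[/EY[]//|/imfsetP[i /= iB ->]]; apply: BX.
  by rewrite cardfsU (eqP (EF : _ == _)) cardfs0 subn0 cE cF subnK.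
apply/setP => i; rewrite !inE; apply/orP/idP => [[/EY[_ /=]|]|iB].
- by rewrite ltnS ltn_ord.
- by move=> /imfsetP[j /= jB [/val_inj ->]].
- by right; apply/imfsetP; exists i.
Qed.

(** No trace of a subset of X contains x, so besides the extra colour only
    the members of H avoiding x can give colours. *)
Lemma gamma_le_missing {n r : nat} (H : {set {set 'I_n.+1}}) {X : set nat}
    (x : 'I_n.+1) : ~ X x.+1 ->
  gamma r (trace_colour H) X <= #|[set B in H | x \notin B]%SET|.+1.
Proof.
move=> Xx; pose K := [set B in H | x \notin B]%SET.
pose L := [fset c in #|H|.+1 :: [seq (index B (enum H)).+1 | B <- enum K]]%fset.
have XL : trace_colour H @` rsubsets r X `<=` [set` L].
  move=> _ [e [eX _] <-] /=; rewrite !inE /trace_colour.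
  have [eH|eH] := boolP (trace n e \in H); last first.
    by rewrite memNindex ?mem_enum// -cardE eqxx.
  apply/orP; right; apply: map_f; rewrite mem_enum inE eH inE.
  by apply/negP => /eX.
rewrite /gamma; apply: (@leq_trans #|` L|).
  apply/fsubset_leq_card; rewrite -[L]set_fsetK -fset_set_sub//.
  exact: sub_finite_set XL _.
by rewrite card_fseq (leq_trans (size_undup _))//= size_map -cardE.
Qed.

(** The set outside H accounts for the extra colour. *)
Lemma trace_colour_surj {n r : nat} (H : {set {set 'I_n.+1}}) {X : set nat} :
    infinite_set X -> (forall i : 'I_n.+1, X i.+1) ->
    (forall B, B \in H -> #|B| <= r) ->
    (exists2 B : {set 'I_n.+1}, B \notin H & #|B| <= r) ->
  trace_colour H @` rsubsets r X = palette #|H|.+1.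
Proof.
move=> Xinf nX Hr [B0 B0H cB0].
apply/seteqP; split=> [_ [e _ <-]|c /andP[c0 ck]].
  exact: trace_colour_le.
suff [B cB <-] : exists2 B : {set 'I_n.+1}, #|B| <= r &
    (index B (enum H)).+1 = c.
  have [e eX eB] := trace_surj B Xinf (fun i _ => nX i) cB.
  by exists e => //; rewrite /trace_colour eB.
have [cH|Hc] := ltnP c.-1 #|H|; last first.
  exists B0 => //; rewrite memNindex ?mem_enum// -cardE.
  by apply/eqP; rewrite eqn_leq ck andbT -(prednK c0) ltnS.
rewrite cardE in cH; exists (nth B0 (enum H) c.-1).
  by apply: Hr; rewrite -mem_enum mem_nth.
by rewrite index_uniq ?enum_uniq// prednK.
Qed.

Lemma card_palette (k : nat) : #|` fset_set (palette k)| = k.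
Proof.
have -> : palette k = [set` [fset c in iota 1 k]%fset].
  by apply/seteqP; split=> c /=; rewrite inE mem_iota add1n ltnS.
by rewrite set_fsetK card_fseq undup_id ?iota_uniq// size_iota.
Qed.

Theorem theorem1p4 (r : nat) (hr : 3 <= r) :
  infinite_set [set n : nat | 0 < n /\
    exists k : nat, binsum r n.-1 < k /\
      exists Delta : {fset nat} -> nat,
        surjective_colouring r k Delta /\
        calF r Delta `&` J r n = set0].
Proof.
suff large n : r <= n -> 0 < n /\ exists k : nat, binsum r n.-1 < k /\
      exists Delta : {fset nat} -> nat,
        surjective_colouring r k Delta /\ calF r Delta `&` J r n = set0.
  move=> fin; have : finite_set (~` `I_r).
    by apply: sub_finite_set fin => n /= /negP; rewrite -leqNgt => /large.
  have := @infinite_setD _ _ _ infinite_nat (finite_II r).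
  by rewrite setTD.
move=> rn; have n0 : 0 < n by lia.
have [H [cH Hr HB Hx]] : exists H : {set {set 'I_n.+1}},
    [/\ #|H| = binsum r n, forall B, B \in H -> #|B| <= r,
        exists2 B : {set 'I_n.+1}, B \notin H & #|B| <= r &
        forall x, #|[set B in H | x \notin B]%SET| < binsum r n.-1].
  by apply: exists_arc_family; rewrite hr.
split=> //; exists (binsum r n).+1; split.
  rewrite ltnS; apply: leq_sum => i _; apply: leq_bin2l; exact: leq_pred.
have full X : infinite_set X -> (forall i : 'I_n.+1, X i.+1) ->
    trace_colour H @` rsubsets r X = palette (binsum r n).+1.
  by move=> Xinf nX; rewrite (trace_colour_surj H Xinf nX Hr HB) cH.
have posinf : infinite_set posnat.
  have := @infinite_setD _ _ _ infinite_nat (finite_II 1).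
  rewrite setTD; apply: contra_not; apply: sub_finite_set => x /=.
  by move=> /negP; rewrite -leqNgt.
exists (trace_colour H); split.
  have := full posnat posinf (fun=> erefl) => posE.
  split=> [e eX|]; last by rewrite /set_surj posE.
  by rewrite -posE; exists e.
rewrite -subset0 => m [[X [_ Xinf] <-] /andP[lo hi]].
have [nX|/existsNP[x Xx]] := pselect (forall i : 'I_n.+1, X i.+1).
  by move: hi; rewrite /gamma (full X Xinf nX) card_palette ltnn.
have := leq_trans (gamma_le_missing (r := r) H x Xx) (Hx x).
by rewrite leqNgt lo.
Qed.
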